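(* Let $m,k$ be integers and let $\mathbf u=(u_0,\dots,u_{k-1})$, $\mathbf v=(v_0,\dots,v_{k-1})$ with $u_i=(2i,-2i)$ and $v_i=(2i+3,m-k-i-1)$ for $0\le i\le k-1$. (i) If $m\ge0$ and $0\le k\le m$, then $P_{m,k}(q)$ equals the sum, over all families $(L_0,\dots,L_{k-1})$ of pairwise non-intersecting lattice paths with $L_i$ going from $u_i$ to $v_i$, of the product of the weights of all steps, where a vertical step with even $x$-coordinate has weight $q$ and all other steps have weight $1$. (ii) If $m\ge1$ and $0\le k\le m-1$, then $Q_{m,k}(q)$ equals the same sum, where now a vertical step starting at one of the points $u_j$ has weight $q^2+q$, any other vertical step with even $x$-coordinate has weight $q^2$, and all other steps have weight $1$.
   Context: A lattice path is a sequence of points of $\mathbb{Z}^2$ in which each step is $(1,0)$ (horizontal) or $(0,1)$ (vertical); the $x$-coordinate of a vertical step is the common $x$-coordinate of its endpoints. Paths are non-intersecting if they share no lattice point. The empty family ($k=0$) has weight $1$. $[k]=\frac{1-q^k}{1-q}$, $[k]!=\prod_{i=1}^k[i]$, $[0]!=1$. Let $S_{m,n}(q)=\sum_{k=1}^n\frac{[2k]}{[2]}[k]^{m-1}q^{\frac{m+1}{2}(n-k)}$. The polynomials $P_{m,j},Q_{m,j}\in\mathbb{Z}[q]$ are those (shown to exist by Guo and Zeng, and uniquely determined) such that for all $n\ge1$: $S_{2m+1,n}(q)=\sum_{k=0}^m(-q^n)^{m-k}\frac{[k]!}{[m+1]!}P_{m,m-k}(q)\frac{([n][n+1])^{k+1}}{[2]}$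 for $m\ge0$, and $S_{2m,n}(q)=(1-q^{n+\frac12})\sum_{k=0}^m(-q^n)^{m-k}\frac{(1-q^{\frac12})^{m-k}Q_{m,m-k}(q^{\frac12})}{\prod_{i=0}^{m-k}(1-q^{m-i+\frac12})}\frac{([n][n+1])^k}{[2]}$ for $m\ge1$. *)

(* Defs.v *)
From HB Require Import structures.
From mathcomp Require Import all_boot all_order all_algebra.
Set Implicit Arguments. Unset Strict Implicit. Unset Printing Implicit Defensive.
Import Order.TTheory GRing.Theory Num.Theory.
Local Open Scope ring_scope.

Definition qint (R : realFieldType) (q : R) (k : nat) : R := (1 - q ^+ k) / (1 - q).
Definition qfact (R : realFieldType) (q : R) (k : nat) : R :=
  \prod_(1 <= i < k.+1) qint q i.

(* S_{m,n}(q) = sum_{k=1}^n [2k]/[2] [k]^{m-1} q^{(m+1)/2 (n-k)},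
   written with q = t^2 so that q^{(m+1)/2 (n-k)} = t^{(m+1)(n-k)}. *)
Definition Ssum (R : realFieldType) (m n : nat) (t : R) : R :=
  \sum_(1 <= k < n.+1)
     qint (t ^+ 2) (2 * k) / qint (t ^+ 2) 2 * qint (t ^+ 2) k ^+ m.-1
       * t ^+ ((m + 1) * (n - k)).

Definition peval (R : realFieldType) (p : {poly int}) (x : R) : R :=
  (map_poly (fun z : int => z%:~R) p).[x].

Definition Z2 := (int * int)%type.

Definition next (p : Z2) (b : bool) : Z2 :=
  if b then (p.1, p.2 + 1) else (p.1 + 1, p.2).

Fixpoint points (p : Z2) (s : seq bool) : seq Z2 :=
  if s is b :: s' then p :: points (next p b) s' else [:: p].

Definition endpt (p : Z2) (s : seq bool) : Z2 := last p (points p s).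

Fixpoint bseqs (n : nat) : seq (seq bool) :=
  if n is n'.+1 then [seq b :: s | b <- [:: false; true], s <- bseqs n'] else [:: [::]].

(* all lattice paths from u to v (every such path has exactly
   (v.1 + v.2) - (u.1 + u.2) steps) *)
Definition all_paths (u v : Z2) : seq (seq bool) :=
  [seq s <- bseqs (absz ((v.1 + v.2) - (u.1 + u.2))%R) | endpt u s == v].

Fixpoint families (ends : seq (Z2 * Z2)) : seq (seq (seq bool)) :=
  if ends is e :: ends' then
    [seq L :: f | L <- all_paths e.1 e.2, f <- families ends']
  else [:: [::]].

Definition nonintersecting (ends : seq (Z2 * Z2)) (f : seq (seq bool)) : bool :=
  pairwise (fun a b : seq Z2 => ~~ has (fun x => x \in b) a)
    [seq points x.1.1 x.2 | x <- zip ends f].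

Fixpoint path_weight (T : comRingType) (w : Z2 -> T) (p : Z2) (s : seq bool) : T :=
  if s is b :: s' then (if b then w p else 1) * path_weight w (next p b) s'
  else 1.

Definition lgv_sum (T : comRingType) (w : Z2 -> T) (ends : seq (Z2 * Z2)) : T :=
  \sum_(f <- families ends | nonintersecting ends f)
     \prod_(x <- zip ends f) path_weight w x.1.1 x.2.

Definition u_pt (i : nat) : Z2 := ((2 * i)%:Z, - (2 * i)%:Z).
Definition v_pt (m k i : nat) : Z2 := ((2 * i + 3)%:Z, m%:Z - k%:Z - i%:Z - 1).
Definition ends_uv (m k : nat) : seq (Z2 * Z2) :=
  [seq (u_pt i, v_pt m k i) | i <- iota 0 k].

Definition evenx (p : Z2) : bool := ~~ odd (absz p.1).

Definition wP (p : Z2) : {poly int} := if evenx p then 'X else 1.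
Definition wQ (k : nat) (p : Z2) : {poly int} :=
  if p \in [seq u_pt j | j <- iota 0 k] then 'X ^+ 2 + 'X
  else if evenx p then 'X ^+ 2 else 1.

(* Main.v *)
Require Import Defs.
From HB Require Import structures.
From mathcomp Require Import all_boot all_order all_algebra.
From mathcomp Require Import perm zify ring lra.
(* [next] must denote the step of Defs, not [path.next]. *)
Import Defs.
Import Order.TTheory GRing.Theory Num.Theory.
Set Implicit Arguments. Unset Strict Implicit. Unset Printing Implicit Defensive.
Local Open Scope ring_scope.

(** Put [z = [n]], [x = q^n] and [X = x / z^2].  Since
    [[n+1] + q[n-1] = (1 + q) z] and [[n+1] * q[n-1] = q z^2 - x], the quotient
    [([n+1]^(j+1) - (q[n-1])^(j+1)) / (1 + x)] is [z^j H_j(X)] for a polynomial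
    [H_j].  Subtracting [q^((m+1)/2)] times the Guo--Zeng identity at [n-1]
    from the identity at [n] therefore gives
    [1 = \sum_s (-X)^s c_s P_s H_(m-s)(X)] for infinitely many [X]; comparing
    coefficients yields a triangular system for the [P_s], which Cramer's rule
    solves by a Hessenberg determinant of coefficients of the [H_j].  The same
    works for [Q_s] with [H_j + t H_(j-1)], [q = t^2].  These coefficients
    count weighted lattice paths, and the determinant is that of the
    Lindstroem--Gessel--Viennot lemma with rows and columns reversed. *)

(** * Non-intersecting paths starting on an antidiagonal *)

Definition level (p : Z2) : int := p.1 + p.2.

Lemma level_next p b : level (next p b) = level p + 1.
Proof. by rewrite /level; case: b => /=; ring. Qed.

Lemma endpt_cons p b s : endpt p (b :: s) = endpt (next p b) s.
Proof. by rewrite /endpt /=; case: s. Qed.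

Lemma mem_points_level p s x : x \in points p s -> x = p \/ level p < level x.
Proof.
elim: s p => [|b s IH] p /=; first by rewrite inE => /eqP; left.
rewrite inE => /orP[/eqP|/IH]; first by left.
by rewrite level_next => -[->|]; right; rewrite ?level_next; lia.
Qed.

Lemma endpt_ge p s : p.1 <= (endpt p s).1 /\ p.2 <= (endpt p s).2.
Proof.
elim: s p => [|b s IH] p; first by rewrite /endpt /=.
by rewrite endpt_cons; have := IH (next p b); case: b => /=; lia.
Qed.

Lemma size_bseqs n s : s \in bseqs n -> size s = n.
Proof.
elim: n s => [|n IH] s /=; first by rewrite inE => /eqP->.
by rewrite cats0 mem_cat => /orP[] /mapP[s' /IH <- ->].
Qed.

Lemma all_paths_step u v : level u < level v ->
  all_paths u v = [seq false :: s | s <- all_paths (next u false) v]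
               ++ [seq true :: s | s <- all_paths (next u true) v].
Proof.
rewrite /all_paths -/(level u) -/(level v) => uv.
have eD b : absz (v.1 + v.2 - ((next u b).1 + (next u b).2))%R = (absz (level v - level u)%R).-1.
  by move: uv (level_next u b); rewrite /level; lia.
rewrite !eD; have -> : absz (level v - level u)%R = (absz (level v - level u)%R).-1.+1 by lia.
rewrite /= cats0 filter_cat !filter_map.
by congr cat; congr map; apply: eq_filter => s /=; rewrite endpt_cons.
Qed.

Lemma all_paths_refl u v : level u = level v -> all_paths u v = if u == v then [:: [::]] else [::].
Proof. by move=> uv; rewrite /all_paths -/(level v) -/(level u) uv subrr. Qed.

Section LGV.
Variables (T : comNzRingType) (w : Z2 -> T).

Definition path_sum (u v : Z2) : T := \sum_(s <- all_paths u v) path_weight w u s.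

Definition step_weight (b : bool) (p : Z2) : T := if b then w p else 1.

Lemma path_sum_step u v : level u < level v ->
  path_sum u v = path_sum (next u false) v + w u * path_sum (next u true) v.
Proof.
move=> uv; rewrite /path_sum all_paths_step // big_cat !big_map /=; congr (_ + _).
  by apply: eq_bigr => s _; rewrite mul1r.
by rewrite big_distrr.
Qed.

Lemma path_sum_refl u v : level u = level v -> path_sum u v = (u == v)%:R.
Proof.
by move=> uv; rewrite /path_sum all_paths_refl //; case: eqP => _; rewrite ?big_seq1 ?big_nil.
Qed.

Lemma path_sum_out u v : (v.1 < u.1) || (v.2 < u.2) -> path_sum u v = 0.
Proof.
move=> uv; rewrite /path_sum big_seq big_pred0 // => s.
rewrite /all_paths mem_filter; case: eqP => //= E.
by have := endpt_ge u s; rewrite E !leNgt => -[/negbTE e1 /negbTE e2]; rewrite e1 e2 in uv.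
Qed.

(** Recursive, with shifted endpoint functions, so that unfolding peels off the first path in step
    with [families]. *)
Fixpoint ends_of (u v : nat -> Z2) k : seq (Z2 * Z2) :=
  if k is k'.+1 then (u 0%N, v 0%N) :: ends_of (fun i => u i.+1) (fun i => v i.+1) k' else [::].

Lemma ends_ofE u v k : ends_of u v k = mkseq (fun i => (u i, v i)) k.
Proof.
elim: k u v => //= k IH u v.
by rewrite IH /mkseq /= -[1%N]addn0 iotaDl -map_comp.
Qed.

Lemma size_ends_of u v k : size (ends_of u v k) = k.
Proof. by rewrite ends_ofE size_mkseq. Qed.

Lemma nth_ends_of x u v k i : (i < k)%N -> nth x (ends_of u v k) i = (u i, v i).
Proof. by move=> ik; rewrite ends_ofE nth_mkseq. Qed.

Definition cons_steps (e : seq bool) (f : seq (seq bool)) := [seq x.1 :: x.2 | x <- zip e f].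

Definition move_by (e : seq bool) (u : nat -> Z2) i := next (u i) (nth false e i).

Lemma size_families u v k f : f \in families (ends_of u v k) -> size f = k.
Proof.
elim: k u v f => [|k IH] u v f; first by rewrite inE => /eqP->.
by move=> /= /allpairsP[[L g] /= [_ /IH <- ->]].
Qed.

(** Every path has at least one step left, so a family is a choice [e] of first steps followed by a
    family from the moved starts. *)
Lemma big_families_step u v k (F : seq (seq bool) -> T) :
  (forall i, (i < k)%N -> level (u i) < level (v i)) ->
  \sum_(f <- families (ends_of u v k)) F f =
  \sum_(e <- bseqs k) \sum_(f <- families (ends_of (move_by e u) v k)) F (cons_steps e f).
Proof.
elim: k u v F => [|k IH] u v F uv; first by rewrite !big_seq1.
rewrite /= cats0 all_paths_step ?uv // big_cat /=.
rewrite big_allpairs_dep big_cat /= !big_map; congr (_ + _).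
all: rewrite (eq_bigr _ (fun s _ => IH _ _ (fun f => F ((_ :: s) :: f)) (fun i => uv i.+1))).
all: rewrite exchange_big /=; apply: eq_bigr => e _.
all: by rewrite big_allpairs_dep; apply: eq_bigr => s _; apply: eq_bigr.
Qed.

Lemma big_bseqs k (c : nat -> bool -> T) :
  \sum_(e <- bseqs k) \prod_(i < k) c i (nth false e i) =
  \prod_(i < k) (c i false + c i true).
Proof.
elim: k c => [|k IH] c; first by rewrite big_seq1 !big_ord0.
rewrite big_ord_recl /= cats0 big_cat !big_map /= mulrDl.
by congr (_ + _); rewrite -(IH (fun i => c i.+1)) big_distrr; apply: eq_bigr => e _; rewrite big_ord_recl.
Qed.

Definition family_weight (ends : seq (Z2 * Z2)) f := \prod_(x <- zip ends f) path_weight w x.1.1 x.2.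

Lemma family_weight_step u v k e f : size e = k -> size f = k ->
  family_weight (ends_of u v k) (cons_steps e f) =
  \prod_(i < k) step_weight (nth false e i) (u i) * family_weight (ends_of (move_by e u) v k) f.
Proof.
rewrite /family_weight /cons_steps.
elim: k u v e f => [|k IH] u v [|b e] [|s f] //=; first by rewrite !big_ord0 !big_nil mulr1.
move=> [se] [sf]; rewrite /= !big_cons /= IH // big_ord_recl /=.
by rewrite -!mulrA; congr (_ * _); rewrite mulrCA.
Qed.

Lemma nonintersectingP u v k f : size f = k ->
  reflect (forall i j, (i < j < k)%N -> forall x,
             x \in points (u i) (nth [::] f i) -> x \notin points (u j) (nth [::] f j))
          (nonintersecting (ends_of u v k) f).
Proof.
move=> sf; set l := [seq points x.1.1 x.2 | x <- zip (ends_of u v k) f].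
have sl : size l = k by rewrite size_map size_zip size_ends_of sf minnn.
have nl i : (i < k)%N -> nth [::] l i = points (u i) (nth [::] f i).
  move=> ik; rewrite (nth_map ((u 0%N, v 0%N), [::])) ?size_zip ?size_ends_of ?sf ?minnn //.
  by rewrite nth_zip ?size_ends_of ?sf //= nth_ends_of.
rewrite /nonintersecting -/l; apply: (iffP (pairwiseP [::])).
  move=> H i j /andP[ij jk] x xi; have ik := ltn_trans ij jk.
  have := H i j; rewrite !inE sl => /(_ ik jk ij) /hasPn; rewrite !nl //.
  exact.
move=> H i j; rewrite !inE sl => ik jk ij; rewrite !nl //.
by apply/hasPn => x; apply: H; rewrite ij.
Qed.

(** The starts are distinct points of one antidiagonal and all later points lie on higher ones, so
    the starts never cause an intersection. *)
Lemma nonintersecting_step u v k e f c : size e = k -> size f = k ->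
  (forall i, (i < k)%N -> level (u i) = c) ->
  (forall i j, (i < j < k)%N -> u i != u j) ->
  nonintersecting (ends_of u v k) (cons_steps e f) =
  nonintersecting (ends_of (move_by e u) v k) f.
Proof.
move=> se sf uc uneq.
have sz : size (cons_steps e f) = k by rewrite size_map size_zip se sf minnn.
have nE i : (i < k)%N -> nth [::] (cons_steps e f) i = nth false e i :: nth [::] f i.
  by move=> ik; rewrite (nth_map (false, [::])) ?size_zip ?se ?sf ?minnn // nth_zip ?se ?sf.
apply/(nonintersectingP u v sz)/(nonintersectingP (move_by e u) v sf) => H i j ijk x.
  have [ij jk] := andP ijk; have ik := ltn_trans ij jk.
  have := H i j ijk x; rewrite !nE //= !inE => + xi; rewrite xi orbT => /(_ isT).
  by rewrite negb_or => /andP[].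
have [ij jk] := andP ijk; have ik := ltn_trans ij jk.
have up l : (l < k)%N -> forall y, y \in points (move_by e u l) (nth [::] f l) -> level y != c.
  move=> lk y /mem_points_level; rewrite /move_by => -[->|]; rewrite ?level_next ?uc //; lia.
have := H i j ijk x; rewrite !nE //= !inE => Hx /orP[/eqP xui|/[dup] xi /Hx xj].
  rewrite negb_or xui uneq //=; apply: contraTN isT => /(up _ jk); by rewrite uc ?eqxx.
rewrite negb_or xj andbT; apply: contraTneq (up _ ik _ xi) => ->; by rewrite uc ?eqxx.
Qed.

Lemma lgv_sum_step u v k c :
  (forall i, (i < k)%N -> level (u i) = c) ->
  (forall i j, (i < j < k)%N -> u i != u j) ->
  (forall i, (i < k)%N -> c < level (v i)) ->
  lgv_sum w (ends_of u v k) =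
  \sum_(e <- bseqs k) (\prod_(i < k) step_weight (nth false e i) (u i)) *
                      lgv_sum w (ends_of (move_by e u) v k).
Proof.
move=> uc uneq cv; rewrite /lgv_sum big_mkcond big_families_step; last by move=> i ik; rewrite uc ?cv.
rewrite big_seq [RHS]big_seq; apply: eq_bigr => e /size_bseqs se.
rewrite big_distrr /= [RHS]big_mkcond big_seq [RHS]big_seq; apply: eq_bigr => f /size_families sf.
rewrite (nonintersecting_step v se sf uc uneq); case: ifP => // _.
exact: family_weight_step.
Qed.

Lemma lgv_sum_meet u v k i j : (i < j < k)%N -> u i = u j -> lgv_sum w (ends_of u v k) = 0.
Proof.
move=> ijk uij; rewrite /lgv_sum big_seq_cond big_pred0 // => f.
apply/negbTE/negP => /andP[/size_families sf /(nonintersectingP u v sf) /(_ i j ijk (u i))].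
have hd p s : p \in points p s by case: s => [|b s] /=; rewrite inE eqxx.
by rewrite hd {1}uij hd => /(_ isT).
Qed.

Definition lgv_mx (u v : nat -> Z2) k : 'M[T]_k := \matrix_(i, j) path_sum (u i) (v j).

(** In the Leibniz formula each entry splits over its first step; expanding the products gives one
    choice of step per row, common to all permutations. *)
Lemma det_lgv_mx_step u v k :
  (forall i j, (i < k)%N -> (j < k)%N -> level (u i) < level (v j)) ->
  \det (lgv_mx u v k) =
  \sum_(e <- bseqs k) (\prod_(i < k) step_weight (nth false e i) (u i)) *
                      \det (lgv_mx (move_by e u) v k).
Proof.
move=> uv; under [RHS]eq_bigr => e _ do rewrite big_distrr /=.
rewrite exchange_big; apply: eq_bigr => s _ /=.
under [RHS]eq_bigr => e _ do rewrite mulrCA.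
rewrite -big_distrr /=; congr (_ * _).
(* The permutation [s] is extended by 0 to all of [nat], since [big_bseqs] takes factors indexed by
   [nat]. *)
pose cc (i : nat) b := step_weight b (u i) *
  path_sum (next (u i) b) (v (oapp (fun i => s i : nat) 0%N (insub i : option 'I_k))).
transitivity (\prod_(i < k) (cc i false + cc i true)).
  apply: eq_bigr => i _; rewrite /cc valK /= mxE path_sum_step ?uv // mul1r //.
rewrite -big_bseqs; apply: eq_bigr => e _; rewrite -big_split; apply: eq_bigr => i _.
by rewrite /cc valK /= mxE.
Qed.

(* Sweeping the antidiagonals, the determinant splits multilinearly over the
   next steps of all paths; two paths that meet give equal rows.  Since [v 0]
   lies on the lowest antidiagonal and is the highest endpoint, column 0
   removes the first path once that antidiagonal is reached. *)
Lemma lgv_sum_det u v k c :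
  (forall i, (i < k)%N -> level (u i) = c) ->
  (forall i j, (i < j < k)%N -> (u i).1 < (u j).1) ->
  (forall i, (i < k)%N -> c <= level (v i)) ->
  (forall i j, (i <= j < k)%N -> level (v i) <= level (v j)) ->
  (forall i j, (i <= j < k)%N -> (v j).2 <= (v i).2) ->
  lgv_sum w (ends_of u v k) = \det (lgv_mx u v k).
Proof.
elim: k u v c => [|k IHk] u v c uc ui cv vl v2.
  by rewrite /lgv_sum det_mx00 big_mkcond big_seq1 /= big_nil.
(* The inner induction runs on the number [d] of antidiagonals to sweep before reaching that of
   [v 0]. *)
have [d dE] : {d : nat | level (v 0%N) = c + d%:Z}.
  by exists (absz (level (v 0%N) - c)%R); have := cv 0%N isT; lia.
elim: d u c uc ui cv dE => [|d IHd] u c uc ui cv dE; last first.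
  have uneq i j : (i < j < k.+1)%N -> u i != u j.
    by move=> /ui lt; apply: contraTneq lt => ->; rewrite ltxx.
  have cv' j : (j < k.+1)%N -> c < level (v j).
    by move=> jk; have := vl 0%N j; rewrite leq0n jk => /(_ isT); lia.
  rewrite (lgv_sum_step uc uneq cv') det_lgv_mx_step; last by move=> i j ik jk; rewrite uc ?cv'.
  apply: eq_bigr => e _; congr (_ * _).
  have lev' i : (i < k.+1)%N -> level (move_by e u i) = c + 1.
    by move=> ik; rewrite level_next uc.
  have [H|] := boolP [forall i : 'I_k.+1, forall j : 'I_k.+1,
      (i < j)%N ==> ((move_by e u i).1 < (move_by e u j).1)].
    apply: (IHd _ (c + 1)) => // [i j /andP[ij jk]|i ik|]; last by lia.
      have ik := ltn_trans ij jk.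
      by have /forallP/(_ (Ordinal jk))/implyP/(_ ij) := forallP H (Ordinal ik).
    by have := cv' i ik; lia.
  rewrite negb_forall => /existsP[i]; rewrite negb_forall => /existsP[j].
  rewrite negb_imply => /andP[ij nlt].
  have ijk : (i < j < k.+1)%N by rewrite ij /=.
  (* One step changes a first coordinate by at most 1, so the order fails only if the starts were
     neighbours, [i] went right and [j] went up. *)
  have meet : move_by e u i = move_by e u j.
    have := lev' i (ltn_ord i); have := lev' j (ltn_ord j); move: nlt (ui _ _ ijk).
    rewrite /move_by /level; case: (u i) (u j) => [a b] [a' b'].
    case: (nth _ _ i); case: (nth _ _ j) => /= *; congr (_, _); lia.
  rewrite (lgv_sum_meet _ ijk meet); apply/esym/(determinant_alternate (i1 := i) (i2 := j)).
    by rewrite neq_ltn ij.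
  by move=> l; rewrite !mxE meet.
have l0 : level (u 0%N) = level (v 0%N) by rewrite uc // dE addr0.
(* If the first path is already at its end, column 0 is the first unit vector and deleting row and
   column 0 leaves the problem for [k] paths. *)
have [E|N] := eqVneq (u 0%N) (v 0%N).
  rewrite (expand_det_col _ ord0) big_ord_recl big1 ?addr0; last first.
    move=> i _; rewrite mxE path_sum_refl; last by rewrite uc // dE addr0.
    rewrite -E; case: eqP => [H|]; last by rewrite mul0r.
    by have := ui 0%N i.+1 (ltn_ord i); rewrite -H lift0 /= ltxx.
  rewrite mxE path_sum_refl // E eqxx mul1r /cofactor addn0 expr0 mul1r.
  transitivity (\det (lgv_mx (fun i => u i.+1) (fun i => v i.+1) k)); last first.
    by congr (\det _); apply/matrixP => i j; rewrite !mxE !lift0.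
  rewrite -(IHk _ _ c) => [|i ik|i j ij|i ik|i j ij|i j ij]; last first.
  - exact: v2.
  - exact: vl.
  - exact: cv.
  - exact: ui.
  - exact: uc.
  rewrite /lgv_sum /= all_paths_refl // E eqxx  /= cats0 big_map.
  rewrite big_seq_cond [RHS]big_seq_cond.
  apply: eq_big => [f|f _]; last by rewrite big_cons /= mul1r.
  have [/size_families sf|//] := boolP (f \in _); rewrite /nonintersecting /=.
  (* The one-point path at [u 0] meets no other path: their points are starts further right or lie
     on higher antidiagonals. *)
  rewrite [X in X && _](_ : _ = true) //.
  rewrite all_map; apply/allP => -[e s] /(nthP ((u 0%N, v 0%N), [::]))[i].
  rewrite size_zip size_ends_of sf minnn => ik.
  rewrite nth_zip ?size_ends_of ?sf // nth_ends_of // => -[<- _] /=.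
  rewrite orbF -E; apply: contraTN isT => /mem_points_level.
  rewrite !uc // ltxx => -[H|//].
  by have := ui 0%N i.+1 ik; rewrite -H ltxx.
have -> : lgv_sum w (ends_of u v k.+1) = 0.
  by rewrite /lgv_sum /= all_paths_refl // (negbTE N) big_nil.
(* Now [u 0] and [v 0] differ. If [v 0] is to the right, it is lower than [u 0], hence so is every
   endpoint, and row 0 vanishes. Otherwise no start equals [v 0], and column 0 vanishes. *)
have [lt|ge] := ltP (u 0%N).1 (v 0%N).1.
  rewrite (expand_det_row _ ord0) big1 // => j _; rewrite mxE path_sum_out ?mul0r //.
  have := v2 0%N j (ltn_ord j); move: l0; rewrite /level /=; lia.
rewrite (expand_det_col _ ord0) big1 // => i _; rewrite mxE path_sum_refl; last by rewrite uc // dE addr0.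
case: eqP => [H|]; last by rewrite mul0r.
case: (posnP i) => [i0|i0]; first by move: H N; rewrite i0 => ->; rewrite eqxx.
by have := ui 0%N i; rewrite i0 ltn_ord H ltNge ge => /(_ isT).
Qed.

End LGV.

(** * Path counts and the triangular system *)

Lemma nat_ind2 (P : nat -> Prop) :
  P 0%N -> P 1%N -> (forall n, P n -> P n.+1 -> P n.+2) -> forall n, P n.
Proof.
move=> P0 P1 PS n; have [] // : P n /\ P n.+1.
by elim: n => [|n [Pn PSn]] //; split=> //; apply: PS.
Qed.

(* [hpoly q j] at [x / z ^ 2] is [z ^ - j (a ^ (j+1) - b ^ (j+1)) / (a - b)]
   where [a + b = (1 + q) z] and [a b = q z ^ 2 - x]; its coefficient of index
   [i] is the complete symmetric polynomial of degree [j - 2 i] in [i + 1]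
   copies of [1] and [i + 1] copies of [q]. *)
Fixpoint hpoly (T : comNzRingType) (q : T) (j : nat) : {poly T} :=
  match j with
  | 0 => 1
  | j1.+1 => match j1 with
             | 0 => (1 + q)%:P
             | j2.+1 => (1 + q)%:P * hpoly q j1 - (q%:P - 'X) * hpoly q j2
             end
  end.

(** The summand with [t] records the extra weight [t] of a vertical step leaving a start point; for
    [j = 0] the preceding [hpoly] is read as 0. *)
Definition gpoly (T : comNzRingType) (t : T) (j : nat) : {poly T} :=
  hpoly (t ^+ 2) j + t%:P * (if j is j'.+1 then hpoly (t ^+ 2) j' else 0).

Lemma hpolySS (T : comNzRingType) (q : T) j :
  hpoly q j.+2 = (1 + q)%:P * hpoly q j.+1 - (q%:P - 'X) * hpoly q j.
Proof. by []. Qed.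

Lemma coef_hpolySS (T : comNzRingType) (q : T) j i :
  (hpoly q j.+2)`_i = (1 + q) * (hpoly q j.+1)`_i - q * (hpoly q j)`_i
                      + (if i is i'.+1 then (hpoly q j)`_i' else 0).
Proof.
by rewrite hpolySS mulrBl opprB !coefD !coefN !coefCM coefXM; case: i => [|i] /=; ring.
Qed.

Lemma map_hpoly (T U : comNzRingType) (f : {rmorphism T -> U}) (q : T) j :
  map_poly f (hpoly q j) = hpoly (f q) j.
Proof.
elim/nat_ind2: j => [||j IH0 IH1]; first by rewrite rmorph1.
  by rewrite /= map_polyC /= (rmorphD f) (rmorph1 f).
rewrite !hpolySS !rmorphB !rmorphM !rmorphB /= IH0 IH1 !map_polyC map_polyX.
by rewrite /= (rmorphD f) (rmorph1 f).
Qed.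

Lemma map_gpoly (T U : comNzRingType) (f : {rmorphism T -> U}) (t : T) j :
  map_poly f (gpoly t j) = gpoly (f t) j.
Proof.
rewrite /gpoly rmorphD rmorphM /= map_polyC map_hpoly rmorphXn.
by case: j => [|j]; rewrite ?rmorph0 ?map_hpoly ?rmorphXn.
Qed.

Definition even_weight (T : comNzRingType) (q : T) (p : Z2) : T := if evenx p then q else 1.

(** The [j - 2 i] vertical steps are spread over [i + 1] even columns of weight [q] and [i + 1] odd
    ones of weight 1. Expanding the first two steps reproduces the recurrence of [hpoly]. *)
Lemma path_sum_even (T : comNzRingType) (q : T) j i u v :
  evenx u -> v.1 = u.1 + (2 * i + 1)%N%:Z -> level v = level u + j.+1%:Z ->
  path_sum (even_weight q) u v = (hpoly q j)`_i.
Proof.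
have lt p p' k : level p' = level p + k.+1%:Z -> level p < level p' by lia.
elim/nat_ind2: j i u v => [||j IH0 IH1] i u v ev v1 vl.
- rewrite path_sum_step ?(lt _ _ 0%N) // !path_sum_refl ?level_next //.
  rewrite /= coef1 /even_weight ev; case: u v ev v1 vl => [a b] [a' b'] /= ev v1.
  rewrite /level /= !xpair_eqE => vl.
  have -> : (a == a') = false by lia.
  have -> : (b == b') = (i == 0)%N by lia.
  have -> : (a + 1 == a') = (i == 0)%N by lia.
  by case: i {v1 vl} => [|i] /=; ring.
- have ev1 : evenx (next u false) = false by move: ev; rewrite /evenx /=; lia.
  rewrite path_sum_step ?(lt _ _ 1%N) //.
  rewrite (path_sum_step _ (u := next u true)) ?(lt _ _ 0%N) ?level_next ?vl; try lia.
  rewrite (path_sum_step _ (u := next u false)) ?(lt _ _ 0%N) ?level_next ?vl; try lia.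
  rewrite !path_sum_refl ?level_next ?vl; try lia.
  rewrite /even_weight ev ev1 /= coefC; case: u v ev ev1 v1 vl => [a b] [a' b'] /= ev _ v1.
  rewrite /level /= !xpair_eqE => vl.
  have -> : (a == a') = false by lia.
  have -> : (b + 1 == b') = (i == 0)%N by lia.
  have -> : (a + 1 == a') = (i == 0)%N by lia.
  have -> : (a + 1 + 1 == a') = false by lia.
  by case: i {v1 vl} => [|i] /=; ring.
have ev1 : evenx (next u false) = false by move: ev; rewrite /evenx /=; lia.
have ev2 : evenx (next (next u false) false) by move: ev; rewrite /evenx /=; lia.
have w0 : even_weight q u = q by rewrite /even_weight ev.
have w1 : even_weight q (next u false) = 1 by rewrite /even_weight ev1.
have w2 : even_weight q (next u true) = q by rewrite /even_weight -[evenx _]/(evenx u) ev.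
rewrite path_sum_step ?(lt _ _ j.+2) // w0.
rewrite (path_sum_step _ (u := next u false)) ?(lt _ _ j.+1) ?level_next ?vl; try lia.
rewrite w1 mul1r.
have E1 : path_sum (even_weight q) (next u true) v = (hpoly q j.+1)`_i.
  by apply: IH1 => //; rewrite level_next vl; lia.
have E2 : path_sum (even_weight q) (next (next u true) true) v = (hpoly q j)`_i.
  by apply: IH0 => //; rewrite !level_next vl; lia.
(* Right-then-up reaches the same point as up-then-right, so this sum follows from the first-step
   expansion at [next u true]. *)
have -> : path_sum (even_weight q) (next (next u false) true) v =
          (hpoly q j.+1)`_i - q * (hpoly q j)`_i.
  rewrite -[next _ true]/(next (next u true) false) -E1 -E2.
  rewrite (path_sum_step _ (u := next u true)) ?level_next ?vl; last by lia.
  by rewrite w2 addrK.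
rewrite coef_hpolySS.
have -> : path_sum (even_weight q) (next (next u false) false) v =
          if i is i'.+1 then (hpoly q j)`_i' else 0.
  case: i v1 {E1 E2} => [|i] v1.
    by rewrite path_sum_out //= v1; apply/orP; left; lia.
  by apply: IH0 => //; [rewrite v1 /=; lia | rewrite !level_next vl; lia].
rewrite E1; move: (match i with 0 => _ | _ => _ end) => a; move: (_`_i) (_`_i) => b c; ring.
Qed.

Lemma eq_path_sum (T : comNzRingType) (w w' : Z2 -> T) u v :
  (forall p, level u <= level p -> w p = w' p) -> path_sum w u v = path_sum w' u v.
Proof.
move=> eqw; apply: eq_bigr => s _.
elim: s u eqw => //= b s IH u eqw; rewrite eqw // IH // => p up; apply: eqw.
by move: up; rewrite level_next; lia.
Qed.

(** Only a vertical first step feels the changed weight; its surplus [t] multiplies the sum from the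
    point above [u], where one step fewer remains. *)
Lemma path_sum_even_start (T : comNzRingType) (t : T) w j i u v :
  w u = t ^+ 2 + t -> (forall p, level u < level p -> w p = even_weight (t ^+ 2) p) ->
  evenx u -> v.1 = u.1 + (2 * i + 1)%N%:Z -> level v = level u + j.+1%:Z ->
  path_sum w u v = (gpoly t j)`_i.
Proof.
move=> wu weq ev v1 vl.
have uv : level u < level v by rewrite vl; lia.
have H := path_sum_even (t ^+ 2) ev v1 vl.
have w0 : even_weight (t ^+ 2) u = t ^+ 2 by rewrite /even_weight ev.
have eq b : path_sum w (next u b) v = path_sum (even_weight (t ^+ 2)) (next u b) v.
  by apply: eq_path_sum => p up; apply: weq; move: up; rewrite level_next; lia.
rewrite path_sum_step // wu !eq mulrDl addrA.
rewrite /gpoly coefD coefCM -H [in RHS]path_sum_step // w0; congr (_ + _ * _).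
case: j vl {H} => [|j] vl; last by apply: path_sum_even => //; rewrite level_next vl; lia.
rewrite path_sum_refl ?level_next // coef0.
by case: eqP v1 => // <- /=; lia.
Qed.

(* The matrix of the triangular system below, first row and last column removed. *)
Definition hess_mx (T : comNzRingType) (K : nat -> {poly T}) (m k : nat) : 'M[T]_k :=
  \matrix_(i, j) if (j <= i.+1)%N then (K (m - j)%N)`_(i.+1 - j) else 0.

Lemma map_hess_mx (T U : comNzRingType) (f : {rmorphism T -> U}) (K : nat -> {poly T})
    (K' : nat -> {poly U}) m k :
  (forall j, map_poly f (K j) = K' j) -> map_mx f (hess_mx K m k) = hess_mx K' m k.
Proof.
move=> fK; apply/matrixP => i j; rewrite !mxE; case: ifP => _; last by rewrite rmorph0.
by rewrite -fK coef_map.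
Qed.

Lemma det_rev (T : comNzRingType) k (A : 'M[T]_k) :
  \det (\matrix_(i, j) A (rev_ord i) (rev_ord j)) = \det A.
Proof.
pose s := perm (@rev_ord_inj k).
transitivity (\det (row_perm s (col_perm s A))).
  by congr (\det _); apply/matrixP => i j; rewrite !mxE !permE.
rewrite row_permE col_permE !det_mulmx !det_perm mulrCA -[RHS]mulr1; congr (_ * _).
by rewrite odd_permV -signr_addb addbb.
Qed.

(** All starts lie on antidiagonal 0 and endpoint [j] on antidiagonal [m - k + j + 2], at horizontal
    distance [2 (j + 1 - i) + 1] from start [i]. The entry is thus the coefficient of index
    [j + 1 - i] in [K (m - k + j + 1)]: the Hessenberg matrix with both index orders reversed. *)
Lemma lgv_sum_hess (T : comNzRingType) (w : Z2 -> T) (K : nat -> {poly T}) m k :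
  (k <= m)%N ->
  (forall a, (a < k)%N -> forall i j v, v.1 = (u_pt a).1 + (2 * i + 1)%N%:Z ->
     level v = level (u_pt a) + j.+1%:Z -> path_sum w (u_pt a) v = (K j)`_i) ->
  lgv_sum w (ends_uv m k) = \det (hess_mx K m k).
Proof.
move=> km wK.
have lu i : level (u_pt i) = 0 by rewrite /level /=; lia.
have lv j : level (v_pt m k j) = (m - k + j + 2)%N%:Z by rewrite /level /=; lia.
rewrite -det_rev -[ends_uv _ _]ends_ofE (lgv_sum_det w (c := 0)) => [|i _|i j|i _|i j|i j] //=.
- congr (\det _); apply/matrixP => i j; rewrite !mxE /=.
  case: leqP => ij; last first.
    by rewrite path_sum_out //=; apply/orP; left; have := ltn_ord j; lia.
  rewrite (wK i (ltn_ord i) (j.+1 - i)%N (m - k + j + 1)%N); first last.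
  - by rewrite lu lv; lia.
  - by move: (ltn_ord i) (ltn_ord j) => /=; lia.
  by congr ((K _)`_ _); move: (ltn_ord i) (ltn_ord j); lia.
- lia.
- by rewrite lv.
- by rewrite !lv; lia.
- lia.
Qed.

(** The coefficients of index at most [k] form a lower triangular system [A c = e_0]. Multiplying by
    the adjugate solves it without division; the minor without row 0 and last column is
    [hess_mx]. *)
Lemma coef_solve (T : comNzRingType) (K : nat -> {poly T}) (p : nat -> T) m k :
  (k <= m)%N -> \sum_(s < m.+1) p s *: ('X^s * K (m - s)%N) = 1 ->
  p k * \prod_(s < k.+1) (K (m - s)%N)`_0 = (-1) ^+ k * \det (hess_mx K m k).
Proof.
move=> km sumE.
pose A : 'M[T]_k.+1 := \matrix_(r, s) if (s <= r)%N then (K (m - s)%N)`_(r - s) else 0.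
pose c : 'cV[T]_k.+1 := \col_s p s.
have Ac : A *m c = delta_mx ord0 ord0.
  apply/matrixP => r z; rewrite {}[z]ord1 !mxE eqxx andbT.
  pose F s := p s * (if (r < s)%N then 0 else (K (m - s)%N)`_(r - s)).
  transitivity (\sum_(s < k.+1) F s).
    by apply: eq_bigr => s _; rewrite !mxE mulrC /F ltnNge; case: ifP.
  transitivity (\sum_(s < m.+1) F s).
    rewrite (big_ord_widen m.+1 F) ?ltnS // big_mkcond; apply: eq_bigr => s _.
    case: ltnP => // ks; by rewrite /F (leq_trans (ltn_ord r) ks) mulr0.
  rewrite -[RHS](coef1 T r) -sumE coef_sum; apply: eq_bigr => s _.
  by rewrite coefZ coefXnM.
have : \det A * c ord_max ord0 = cofactor A ord0 ord_max.
  transitivity ((\adj A *m (A *m c)) ord_max ord0); first by rewrite mulmxA mul_adj_mx mul_scalar_mx [RHS]mxE.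
  rewrite Ac mxE (bigD1 ord0) //= big1 => [|i i0]; rewrite !mxE ?eqxx ?mulr1 ?addr0 //.
  by rewrite (negbTE i0) mulr0.
rewrite det_trig; last first.
  by apply/is_trig_mxP => i j ij; rewrite mxE leqNgt ij.
rewrite mxE mulrC (eq_bigr (fun s : 'I_k.+1 => (K (m - s)%N)`_0)); last first.
  by move=> s _; rewrite mxE leqnn subnn.
move=> ->; rewrite /cofactor add0n; congr (_ * \det _); apply/matrixP => i j.
by rewrite !mxE lift0 lift_max.
Qed.

(** * From the Guo--Zeng identities to polynomial relations *)

Lemma poly_eq0_inj (F : idomainType) (p : {poly F}) (f : nat -> F) :
  injective f -> (forall n, root p (f n)) -> p = 0.
Proof.
move=> fI fp; apply: (roots_geq_poly_eq0 (rs := map f (iota 0 (size p)))).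
- by apply/allP => x /mapP[n _ ->].
- by rewrite map_inj_uniq ?iota_uniq.
- by rewrite size_map size_iota.
Qed.

(** After scaling by [z ^ j], the recurrence of [hpoly] has characteristic roots [a] and [b]. *)
Lemma horner_hpoly (F : fieldType) (q x z a b : F) j :
  z != 0 -> a + b = (1 + q) * z -> a * b = q * z ^+ 2 - x ->
  (a - b) * (z ^+ j * (hpoly q j).[x / z ^+ 2]) = a ^+ j.+1 - b ^+ j.+1.
Proof.
move=> z0 sE pE; elim/nat_ind2: j => [||j IH0 IH1].
- by rewrite hornerC !expr1 !mulr1.
- by rewrite hornerC expr1 [z * _]mulrC -sE; ring.
have -> : z ^+ j.+2 * (hpoly q j.+2).[x / z ^+ 2] =
    (a + b) * (z ^+ j.+1 * (hpoly q j.+1).[x / z ^+ 2])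
    - a * b * (z ^+ j * (hpoly q j).[x / z ^+ 2]).
  rewrite hpolySS sE pE hornerD hornerN !hornerM hornerD hornerN hornerX !hornerC.
  move: _.[_] _.[_] => h1 h0; rewrite !(exprS z j.+1) (exprS z j).
  by move: (z ^+ j) => zj; field.
rewrite mulrBr (mulrCA _ (a + b)) (mulrCA _ (a * b)) IH0 IH1 !exprS; ring.
Qed.

(** * q-integers at a real [q] between 0 and 1 *)

Section QInt.
Variables (R : realFieldType) (q : R).
Hypothesis q01 : 0 < q < 1.

Let q1 : 1 - q != 0.
Proof. by move: q01 => /andP[_ ?]; rewrite subr_eq0 eq_sym lt_eqF. Qed.

Lemma qintS n : qint q n.+1 = 1 + q * qint q n.
Proof. by rewrite /qint exprS; field. Qed.

Lemma qint_expr n : q ^+ n = 1 - (1 - q) * qint q n.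
Proof. by rewrite /qint; field. Qed.

Lemma qint_double n : qint q (2 * n) = qint q n * (1 + q ^+ n).
Proof. by rewrite /qint mul2n -addnn exprD; field. Qed.

Lemma qint_gt0 n : (0 < n)%N -> 0 < qint q n.
Proof.
move: q01 => /andP[q0 ql]; case: n => // n _; elim: n => [|n IH].
  by rewrite /qint expr1 divff.
by rewrite qintS addr_gt0 // mulr_gt0.
Qed.

(** The map [x / (1 - x)^2] is injective on (0,1), because [x (1 - y)^2 - y (1 - x)^2 = (x - y) (1 -
    x y)]. *)
Lemma qint_ratio_inj : injective (fun n => q ^+ n.+1 / qint q n.+1 ^+ 2).
Proof.
move: (q01) => /andP[q0 ql] i j /eqP.
have nz n : qint q n.+1 ^+ 2 != 0 by rewrite expf_neq0 // gt_eqF // qint_gt0.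
rewrite eqr_div //.
have lt n : q ^+ n.+1 < 1 by rewrite exprn_ilt1 // ltW.
rewrite /qint; set x := q ^+ i.+1; set y := q ^+ j.+1 => E.
have {}E : (x - y) * (1 - x * y) = 0.
  have -> : (x - y) * (1 - x * y) =
      (1 - q) ^+ 2 * (x * ((1 - y) / (1 - q)) ^+ 2 - y * ((1 - x) / (1 - q)) ^+ 2) by field.
  by rewrite (eqP E) subrr mulr0.
have xy : 1 - x * y != 0.
  by rewrite subr_eq0 gt_eqF // mulr_ilt1 ?lt // ltW // exprn_gt0.
move/eqP: E; rewrite mulf_eq0 (negbTE xy) orbF subr_eq0 => /eqP.
have: injective (GRing.exp q) by apply: ieexprIn => //; rewrite lt_eqF.
by move=> inj /inj [].
Qed.

End QInt.

(** * Subtracting consecutive Guo--Zeng identities *)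

Lemma Ssum_rec (R : realFieldType) m n (t : R) :
  Ssum m n.+1 t = t ^+ m.+1 * Ssum m n t
    + qint (t ^+ 2) (2 * n.+1) / qint (t ^+ 2) 2 * qint (t ^+ 2) n.+1 ^+ m.-1.
Proof.
rewrite /Ssum big_nat_recr //= subnn muln0 expr0 mulr1; congr (_ + _).
rewrite big_distrr /=; rewrite big_nat_cond [RHS]big_nat_cond.
apply: eq_bigr => k /andP[/andP[_ kn] _].
rewrite mulrCA -exprD subSn // mulnS addn1; congr (_ * _); congr (_ ^+ _); lia.
Qed.

Section Relations.
Variables (R : realFieldType) (t : R) (m : nat).
Hypothesis t01 : 0 < t < 1.

Let q := t ^+ 2.

Let q01 : 0 < q < 1.
Proof. by move: t01 => /andP[t0 t1]; rewrite exprn_gt0 //= exprn_ilt1 // ltW. Qed.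

Let z n := qint q n.+1.
Let X n := q ^+ n.+1 / z n ^+ 2.

Let qint0 k : (0 < k)%N -> qint q k != 0.
Proof. by move=> k0; rewrite gt_eqF // qint_gt0. Qed.

Let z0 n : z n != 0.
Proof. exact: qint0. Qed.

Let xz n : q ^+ n.+1 = 1 - (1 - q) * z n.
Proof. exact: qint_expr. Qed.

(** The characteristic roots are here [[n+2] = 1 + q * z n] and [q [n] = z n - 1]. *)
Lemma horner_hpoly_qint n j :
  (1 + q ^+ n.+1) * (z n ^+ j * (hpoly q j).[X n]) =
  (1 + q * z n) ^+ j.+1 - (z n - 1) ^+ j.+1.
Proof.
have -> : 1 + q ^+ n.+1 = (1 + q * z n) - (z n - 1) by rewrite xz; ring.
by apply: horner_hpoly => //; rewrite ?xz; ring.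
Qed.

(** With [a], [b] the two roots, the left side is [(1 - t) ((a + t z) a^j - (b + t z) b^j)], and
    [q = t^2] simplifies both prefactors. *)
Lemma horner_gpoly_qint n j :
  (1 - t) * ((1 + q ^+ n.+1) * (z n ^+ j * (gpoly t j).[X n])) =
  (1 - t * q ^+ n.+1) * (1 + q * z n) ^+ j - (t - q ^+ n.+1) * (z n - 1) ^+ j.
Proof.
have -> : 1 - t * q ^+ n.+1 = (1 - t) * (1 + q * z n + t * z n) by rewrite xz /q; ring.
have -> : t - q ^+ n.+1 = (1 - t) * (z n - 1 + t * z n) by rewrite xz /q; ring.
rewrite -!(mulrA (1 - t)) -mulrBr; congr (_ * _).
rewrite /gpoly hornerD hornerM hornerC !mulrDr horner_hpoly_qint.
case: j => [|j]; first by rewrite horner0 !expr1 !expr0; ring.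
have := horner_hpoly_qint n j; rewrite [z n ^+ j.+1]exprS; set h := _.[_] => H.
have -> : (1 + q ^+ n.+1) * (z n * z n ^+ j * (t * h)) =
          t * z n * ((1 + q ^+ n.+1) * (z n ^+ j * h)) by ring.
by rewrite H !exprS; ring.
Qed.

Lemma poly_relation (K : nat -> {poly R}) (p : nat -> R) :
  (forall n, (0 < n)%N -> \sum_(s < m.+1) p s * (X n ^+ s * (K (m - s)%N).[X n]) = 1) ->
  \sum_(s < m.+1) p s *: ('X^s * K (m - s)%N) = 1.
Proof.
move=> H; apply/eqP; rewrite -subr_eq0; apply/eqP.
(* Index 0 is skipped: the relation at [n] uses the identities at [n] and [n + 1], both required to
   be at least 1. *)
apply: (poly_eq0_inj (f := fun n => X n.+1)).
  by move=> i j /(qint_ratio_inj q01) [].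
move=> n; rewrite rootE hornerD hornerN hornerC horner_sum -{1}(H n.+1) // subr_eq0.
by apply/eqP; apply: eq_bigr => s _; rewrite hornerZ hornerM hornerXn.
Qed.

Lemma odd_relation (P : nat -> {poly int}) :
  (forall n, (1 <= n)%N ->
      Ssum (2 * m + 1) n t =
      \sum_(j < m.+1)
        (- q ^+ n) ^+ (m - j) * (qfact q j / qfact q m.+1)
        * peval (P (m - j)%N) q
        * (qint q n * qint q n.+1) ^+ j.+1 / qint q 2) ->
  \sum_(s < m.+1) ((-1) ^+ s * (qfact q (m - s) / qfact q m.+1) * peval (P s) q)
     *: ('X^s * hpoly q (m - s)) = 1.
Proof.
move=> H; apply: (poly_relation
  (p := fun s => (-1) ^+ s * (qfact q (m - s) / qfact q m.+1) * peval (P s) q)) => n n0.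
have := Ssum_rec (2 * m + 1) n t; rewrite -/q -/(z n) !H // => E.
(* The last summand of the sum at [n + 1], which survives the subtraction; dividing by it normalises
   the right side to 1. *)
pose u := qint q (2 * n.+1) / qint q 2 * z n ^+ (2 * m).
have u0 : u != 0.
  by rewrite /u mulf_neq0 ?expf_neq0 ?z0 // mulf_neq0 ?invr_neq0 ?qint0.
apply: (mulfI u0); rewrite mulr1 big_distrr /=.
move/eqP: E; rewrite [X in _ == X]addrC -subr_eq addn1 -/u => /eqP E; rewrite -[in RHS]E.
rewrite big_distrr -sumrB (reindex_inj rev_ord_inj); apply: eq_bigr => j _ /=.
have jm : (j <= m)%N by rewrite -ltnS.
rewrite !subSS subKn // /u qint_double // -/(z n) (qintS q01 n.+1) -/(z n).
set s := (m - j)%N; have mE : m = (s + j)%N by rewrite subnK.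
set c := qfact _ _ / _; set pv := peval _ _.
have bE : q * qint q n = z n - 1 by rewrite /z qintS //; ring.
(* The factor [q^s] turns [(- q^n)^s] into [(- q^(n+1))^s], and [q^(j+1)] turns [[n]^(j+1)] into
   [(z - 1)^(j+1)]. *)
have -> : t ^+ (2 * m).+2 = q ^+ s * q ^+ j.+1.
  by rewrite -exprD /q -exprM; congr (_ ^+ _); lia.
have -> : (z n * (1 + q * z n)) ^+ j.+1 = z n ^+ j.+1 * (1 + q * z n) ^+ j.+1.
  by rewrite exprMn.
have -> : q ^+ s * q ^+ j.+1 * ((- q ^+ n) ^+ s * c * pv * (qint q n * z n) ^+ j.+1 / qint q 2)
   = (- q ^+ n.+1) ^+ s * c * pv * (z n ^+ j.+1 * (z n - 1) ^+ j.+1) / qint q 2.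
  by rewrite -bE [q ^+ n.+1]exprS -mulrN !exprMn; ring.
have := horner_hpoly_qint n j; set h := _.[_] => hE.
have -> : z n ^+ (2 * m) = z n ^+ 2 ^+ s * z n ^+ j * z n ^+ j.
  by rewrite -exprM -!exprD; congr (_ ^+ _); lia.
rewrite /X (exprMn s (q ^+ n.+1)) exprVn (exprNn (q ^+ n.+1)); apply: esym.
transitivity ((-1) ^+ s * q ^+ n.+1 ^+ s * c * pv * z n ^+ j.+1 / qint q 2 *
   ((1 + q ^+ n.+1) * (z n ^+ j * h))); first by rewrite hE; ring.
have := expf_neq0 s (expf_neq0 2 (z0 n)); rewrite [z n ^+ j.+1]exprS.
move: (z n ^+ 2 ^+ s) (q ^+ n.+1 ^+ s) (z n ^+ j) ((-1) ^+ s) => Z x zj e Z0.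
by field; rewrite Z0 qint0.
Qed.

Lemma even_relation (Q : nat -> {poly int}) :
  (forall n, (1 <= n)%N ->
      Ssum (2 * m) n t =
      (1 - t ^+ (2 * n + 1)) *
      \sum_(j < m.+1)
        (- q ^+ n) ^+ (m - j)
        * ((1 - t) ^+ (m - j) * peval (Q (m - j)%N) t
           / \prod_(i < (m - j).+1) (1 - t ^+ (2 * (m - i) + 1)))
        * (qint q n * qint q n.+1) ^+ j / qint q 2) ->
  (1 <= m)%N ->
  \sum_(s < m.+1) ((-1) ^+ s * ((1 - t) ^+ s * peval (Q s) t
           / \prod_(i < s.+1) (1 - t ^+ (2 * (m - i) + 1))) * (1 - t))
     *: ('X^s * gpoly t (m - s)) = 1.
Proof.
move=> H m0; apply: (poly_relation (p := fun s => (-1) ^+ s * ((1 - t) ^+ s * peval (Q s) t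
           / \prod_(i < s.+1) (1 - t ^+ (2 * (m - i) + 1))) * (1 - t))) => n n0.
have := Ssum_rec (2 * m) n t; rewrite -/q -/(z n) !H // => E.
pose u := qint q (2 * n.+1) / qint q 2 * z n ^+ (2 * m).-1.
have u0 : u != 0.
  by rewrite /u mulf_neq0 ?expf_neq0 ?z0 // mulf_neq0 ?invr_neq0 ?qint0.
apply: (mulfI u0); rewrite mulr1.
move/eqP: E; rewrite [X in _ == X]addrC -subr_eq -/u => /eqP E; rewrite -[in RHS]E.
rewrite !big_distrr /= -sumrB (reindex_inj rev_ord_inj); apply: eq_bigr => j _ /=.
have jm : (j <= m)%N by rewrite -ltnS.
rewrite !subSS subKn // /u qint_double // -/(z n) (qintS q01 n.+1) -/(z n).
set s := (m - j)%N; have mE : m = (s + j)%N by rewrite subnK.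
set d := _ / \prod_(_ < _) _.
have bE : q * qint q n = z n - 1 by rewrite /z qintS //; ring.
(* As in the odd case, except that the leftover [t] turns [1 - t q^n] into [t - q^(n+1)]. *)
have -> : t ^+ (2 * m).+1 = t * q ^+ s * q ^+ j.
  by rewrite exprS -mulrA -exprD /q -exprM -mE.
have -> : t ^+ (2 * n.+1 + 1) = t * q ^+ n.+1 by rewrite addn1 exprS exprM.
have -> : (z n * (1 + q * z n)) ^+ j = z n ^+ j * (1 + q * z n) ^+ j by rewrite exprMn.
have -> : t * q ^+ s * q ^+ j * ((1 - t ^+ (2 * n + 1)) *
      ((- q ^+ n) ^+ s * d * (qint q n * z n) ^+ j / qint q 2))
   = (t - q ^+ n.+1) * ((- q ^+ n.+1) ^+ s * d * (z n ^+ j * (z n - 1) ^+ j) / qint q 2).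
  have -> : t ^+ (2 * n + 1) = t * q ^+ n by rewrite addn1 exprS exprM.
  have -> : t - q ^+ n.+1 = t * (1 - t * q ^+ n) by rewrite exprS {1}/q; ring.
  rewrite -bE [q ^+ n.+1]exprS -[- (q * _)]mulrN.
  by rewrite (exprMn s q) (exprMn j q) (exprMn j (qint q n)); ring.
have := horner_gpoly_qint n j; set h := _.[_] => hE.
have -> : z n * (1 + q ^+ n.+1) / qint q 2 * z n ^+ (2 * m).-1 =
   (1 + q ^+ n.+1) / qint q 2 * (z n ^+ 2 ^+ s * z n ^+ j * z n ^+ j).
  have -> : z n ^+ 2 ^+ s * z n ^+ j * z n ^+ j = z n * z n ^+ (2 * m).-1.
    by rewrite -exprM -!exprD -exprS; congr (_ ^+ _); lia.
  by ring.
rewrite /X (exprMn s (q ^+ n.+1)) exprVn (exprNn (q ^+ n.+1)); apply: esym.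
transitivity ((-1) ^+ s * q ^+ n.+1 ^+ s * d * z n ^+ j / qint q 2 *
   ((1 - t) * ((1 + q ^+ n.+1) * (z n ^+ j * h)))); first by rewrite hE; ring.
have := expf_neq0 s (expf_neq0 2 (z0 n)).
move: (z n ^+ 2 ^+ s) (q ^+ n.+1 ^+ s) (z n ^+ j) ((-1) ^+ s) => Z x zj e Z0.
by field; rewrite Z0 qint0.
Qed.

End Relations.

(** * Diagonal entries of the system and the conclusion *)

Lemma hpoly_coef0 (R : realFieldType) (q : R) j : 0 < q < 1 -> (hpoly q j)`_0 = qint q j.+1.
Proof.
move=> q01; have q00 : qint q 0 = 0 by rewrite /qint subrr mul0r.
elim/nat_ind2: j => [||j IH0 IH1]; rewrite ?coef_hpolySS ?IH0 ?IH1 !qintS // ?q00.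
- by rewrite coef1 /=; ring.
- by rewrite coefC /=; ring.
- by ring.
Qed.

(** This is [[2j+1]] in base [t], split into its even powers, [[j+1]] in base [t^2], and its odd
    powers, [t [j]] in base [t^2]. *)
Lemma gpoly_coef0 (R : realFieldType) (t : R) j :
  0 < t < 1 -> (gpoly t j)`_0 = (1 - t ^+ (2 * j + 1)) / (1 - t).
Proof.
move=> /andP[t0 t1]; have q01 : 0 < t ^+ 2 < 1 by rewrite exprn_gt0 //= exprn_ilt1 // ltW.
have n0 : 1 - t != 0 by rewrite subr_eq0 gt_eqF.
have -> : (gpoly t j)`_0 = qint (t ^+ 2) j.+1 + t * qint (t ^+ 2) j.
  rewrite /gpoly coefD coefCM hpoly_coef0 //; congr (_ + _ * _).
  by case: j => [|j]; rewrite ?hpoly_coef0 // coef0 /qint subrr mul0r.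
have n1 : 1 - t ^+ 2 != 0 by rewrite subr_eq0 gt_eqF //; case/andP: q01.
have -> : t ^+ (2 * j + 1) = t * (t ^+ 2) ^+ j by rewrite addn1 exprS exprM.
rewrite qintS // /qint.
by move: (t ^+ 2 ^+ j) => x; field; rewrite n0 n1.
Qed.

(** The product is that of the diagonal entries, so it cancels the quotient of q-factorials attached
    to [P k]. *)
Lemma qfact_prod (R : realFieldType) (q : R) m k : (k <= m)%N ->
  qfact q m.+1 = qfact q (m - k) * \prod_(s < k.+1) qint q (m - s).+1.
Proof.
have qfS n : qfact q n.+1 = qfact q n * qint q n.+1 by rewrite /qfact big_nat_recr.
elim: k => [|k IH] km; first by rewrite big_ord1 subn0 qfS.
by rewrite big_ord_recr /= IH 1?ltnW // -(subnSK km) qfS; ring.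
Qed.

Lemma peval_det (R : realFieldType) k (A : 'M[{poly int}]_k) (x : R) :
  peval (\det A) x = \det (map_mx (horner_eval x \o map_poly intr) A).
Proof. by rewrite det_map_mx. Qed.

Lemma peval_inj (R : realFieldType) (p p' : {poly int}) (f : nat -> R) :
  injective f -> (forall n, peval p (f n) = peval p' (f n)) -> p = p'.
Proof.
move=> fI E; apply: (map_inj_poly (f := intr : int -> R)) => //; first exact: intr_inj.
apply/eqP; rewrite -subr_eq0; apply/eqP; apply: (poly_eq0_inj fI) => n.
rewrite rootE hornerD hornerN subr_eq0; exact/eqP/E.
Qed.

Lemma wQ_off_start (k : nat) u p : level u = 0 -> level u < level p ->
  wQ k p = even_weight ('X ^+ 2) p.
Proof.
move=> -> pl; rewrite /wQ; case: ifP => // /mapP[j _ pE].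
by move: pl; rewrite pE /level /=; lia.
Qed.

(* P m' j plays the role of P_{m,j} / Q_{m,j} for the fixed m; they are
   characterized (uniquely) by the Guo--Zeng identities, evaluated at
   q = t^2 for every real t in (0,1). *)
Theorem theorem3p2 (R : realFieldType) (m k : nat) (P Q : nat -> {poly int}) :
  ((k <= m)%N ->
   (forall (n : nat) (t : R), (1 <= n)%N -> 0 < t < 1 ->
      Ssum (2 * m + 1) n t =
      \sum_(j < m.+1)
        (- (t ^+ 2) ^+ n) ^+ (m - j) * (qfact (t ^+ 2) j / qfact (t ^+ 2) m.+1)
        * peval (P (m - j)%N) (t ^+ 2)
        * (qint (t ^+ 2) n * qint (t ^+ 2) n.+1) ^+ j.+1 / qint (t ^+ 2) 2) ->
   P k = lgv_sum wP (ends_uv m k))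
  /\
  ((1 <= m)%N -> (k <= m - 1)%N ->
   (forall (n : nat) (t : R), (1 <= n)%N -> 0 < t < 1 ->
      Ssum (2 * m) n t =
      (1 - t ^+ (2 * n + 1)) *
      \sum_(j < m.+1)
        (- (t ^+ 2) ^+ n) ^+ (m - j)
        * ((1 - t) ^+ (m - j) * peval (Q (m - j)%N) t
           / \prod_(i < (m - j).+1) (1 - t ^+ (2 * (m - i) + 1)))
        * (qint (t ^+ 2) n * qint (t ^+ 2) n.+1) ^+ j / qint (t ^+ 2) 2) ->
   Q k = lgv_sum (wQ k) (ends_uv m k)).
Proof.
(* Infinitely many sample points strictly between 0 and 1; agreement there determines an integer
   polynomial. *)
pose f n : R := n.+2%:R^-1.
have f01 n : 0 < f n < 1 by rewrite invr_gt0 ltr0n invf_lt1 ?ltr0n // ltr1n.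
have fI : injective f by move=> i j /invr_inj /eqP; rewrite eqr_nat => /eqP [].
have evu a : evenx (u_pt a) by rewrite /evenx /=; lia.
split=> [km H|m0 km1 H].
  rewrite (lgv_sum_hess (K := hpoly 'X) km); last first.
    by move=> a _ i j v; apply: path_sum_even.
  apply: (peval_inj (f := fun n => f n ^+ 2)).
    move=> i j /eqP; rewrite eqrXn2 // => [/eqP/fI //||];
      by case/andP: (f01 i) (f01 j) => /ltW ? _ /andP[/ltW ? _].
  move=> n; have t01 := f01 n; set t := f n in t01 *.
  have q01 : 0 < t ^+ 2 < 1.
    by case/andP: t01 => t0 t1; rewrite exprn_gt0 //= exprn_ilt1 // ltW.
  have := coef_solve
    (p := fun s => (-1) ^+ s * (qfact (t ^+ 2) (m - s) / qfact (t ^+ 2) m.+1) * peval (P s) (t ^+ 2))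
    km (odd_relation (P := P) t01 (fun n n1 => H n t n1 t01)).
  rewrite (eq_bigr (fun s : 'I_k.+1 => qint (t ^+ 2) (m - s).+1)); last first.
    by move=> s _; rewrite hpoly_coef0.
  have nz : qfact (t ^+ 2) m.+1 != 0.
    rewrite /qfact prodf_seq_neq0; apply/allP => i; rewrite mem_index_iota => /andP[i1 _].
    by rewrite /= gt_eqF // qint_gt0.
  have := nz; rewrite (qfact_prod _ km) mulf_eq0 negb_or => /andP[nz1 nz2].
  rewrite peval_det (map_hess_mx (K' := hpoly (t ^+ 2))); last first.
    by move=> j; rewrite map_hpoly /= map_polyX /horner_eval hornerX.
  move: (peval _ _) (\det _) (\prod_(_ < _) _) (qfact _ _) nz1 nz2 => p d a b b0 a0 E.
  apply: (mulfI (_ : (-1) ^+ k != 0 :> R)); first by rewrite signr_eq0.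
  by rewrite -E; field; rewrite a0.
have km : (k <= m)%N by lia.
rewrite (lgv_sum_hess (K := gpoly 'X) km); last first.
  have lu a : level (u_pt a) = 0 by rewrite /level /=; lia.
  move=> a ak i j v; apply: path_sum_even_start => //.
    by rewrite /wQ map_f // mem_iota.
  by move=> p; apply: wQ_off_start.
apply: (peval_inj fI) => n; have t01 := f01 n; set t := f n in t01 *.
have := coef_solve
  (p := fun s => (-1) ^+ s * ((1 - t) ^+ s * peval (Q s) t
           / \prod_(i < s.+1) (1 - t ^+ (2 * (m - i) + 1))) * (1 - t))
  km (even_relation (Q := Q) t01 (fun n n1 => H n t n1 t01) m0).
(* These diagonal entries cancel the denominators attached to [Q k], and their [(1 - t)^(k+1)]
   cancels the powers of [1 - t]. *)
have -> : \prod_(s < k.+1) (gpoly t (m - s)%N)`_0 =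
    \prod_(s < k.+1) ((1 - t ^+ (2 * (m - s) + 1)) / (1 - t)).
  by apply: eq_bigr => s _; rewrite gpoly_coef0.
rewrite peval_det (map_hess_mx (K' := gpoly t)); last first.
  by move=> j; rewrite map_gpoly /= map_polyX /horner_eval hornerX.
have [t0 t1] := andP t01; have n0 : 1 - t != 0 by rewrite subr_eq0 gt_eqF.
rewrite big_split /= prodr_const card_ord exprVn exprS.
have : \prod_(i < k.+1) (1 - t ^+ (2 * (m - i) + 1)) != 0.
  by apply/prodf_neq0 => i _; rewrite subr_eq0 gt_eqF // exprn_ilt1 ?addn1 // ltW.
move: (\prod_(_ < _) _) (\det _) (peval _ _) => a d p a0 E.
apply: (mulfI (_ : (-1) ^+ k != 0 :> R)); first by rewrite signr_eq0.
have := expf_neq0 k n0; rewrite -E; move: ((1 - t) ^+ k) => b b0.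
by field; rewrite b0 a0 n0.
Qed.
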